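(* For any polynomial $f(x)$ of degree $N$ with complex coefficients and any complex number $a$, $$f(x)=\sum_{k=0}^{N}p^{-\binom{k}{2}}\,\frac{\left(D_{p,q}^k f\right)(ap^{-k})}{[k]_{p,q}!}\,(x\ominus a)_{p,q}^k .$$
   Context: $p,q$ are nonzero complex numbers with $p^n\neq q^n$ for all integers $n\ge 1$. The $(p,q)$-derivative is $D_{p,q}f(x)=\dfrac{f(px)-f(qx)}{(p-q)x}$ for $x\neq 0$ and $(D_{p,q}f)(0)=f'(0)$ if $f$ is differentiable at $0$; $D_{p,q}^k$ is its $k$-fold iterate. $[n]_{p,q}=\dfrac{p^n-q^n}{p-q}$, $[n]_{p,q}!=\prod_{k=1}^{n}[k]_{p,q}$ for $n\ge 1$, $[0]_{p,q}!=1$. The $(p,q)$-power is $(x\ominus a)_{p,q}^n=(x-a)(px-qa)\cdots(p^{n-1}x-q^{n-1}a)$ for $n\ge 1$ and $(x\ominus a)_{p,q}^0=1$. *)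

(* Defs.v *)
From mathcomp Require Import all_boot all_order all_algebra.
From mathcomp Require Import complex.
From mathcomp Require Import boolp classical_sets reals topology normedtype derive.

Set Implicit Arguments.
Unset Strict Implicit.
Unset Printing Implicit Defensive.

Import Order.TTheory GRing.Theory Num.Theory.
Import numFieldNormedType.Exports.

Local Open Scope ring_scope.
Local Open Scope complex_scope.

Section PQCalculus.
Variables (R : realType) (p q : R[i]).

(* [derive1] is the complex derivative: the limit of the difference quotient
   over complex increments.  Where [f] is not differentiable at 0 the value at
   0 is unspecified. *)
Definition pq_derive (f : R[i] -> R[i]) (x : R[i]) : R[i] :=
  if x == 0 then derive1 (f : R[i] -> R[i]^o) 0
  else (f (p * x) - f (q * x)) / ((p - q) * x).

Definition pq_deriven (k : nat) (f : R[i] -> R[i]) : R[i] -> R[i] :=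
  iter k pq_derive f.

Definition pq_nat (n : nat) : R[i] := (p ^+ n - q ^+ n) / (p - q).

Definition pq_fact (n : nat) : R[i] := \prod_(1 <= k < n.+1) pq_nat k.

Definition pq_power (x a : R[i]) (n : nat) : R[i] :=
  \prod_(i < n) (p ^+ i * x - q ^+ i * a).

End PQCalculus.

(* Main.v *)
(** The operator D acts on polynomials, where it is linear and, since no
    [n]_{p,q} with n >= 1 vanishes, kills only the constants.  It sends
    (x (-) a)^(n+1) to [n+1] p^n (x (-) a/p)^n, so it sends the expansion of f
    around a to the expansion of D f around a/p.  By induction on the degree, f
    and its expansion have the same image under D, hence differ by a constant,
    which is zero because they agree at x = a. *)
Require Import Defs.
From HB Require Import structures.
From mathcomp Require Import all_boot all_order all_algebra.
From mathcomp Require Import complex ring.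
From mathcomp Require Import boolp functions reals topology normedtype derive.

Import GRing.Theory.
Import numFieldNormedType.Exports.
Local Open Scope ring_scope.
Local Open Scope complex_scope.

Lemma coef_comp_scaleX (F : comNzRingType) (f : {poly F}) (c : F) (i : nat) :
  (f \Po (c *: 'X))`_i = f`_i * c ^+ i.
Proof.
rewrite comp_polyE coef_sum.
under eq_bigr => j _ do rewrite exprZn !coefZ coefXn.
have [lti|lei] := ltnP i (size f).
  rewrite (bigD1 (Ordinal lti)) //= eqxx mulr1 big1 ?addr0// => j /negPf nji.
  by rewrite -val_eqE /= in nji; rewrite eq_sym nji !mulr0.
rewrite nth_default // mul0r big1 // => j _.
by rewrite gtn_eqF ?(leq_trans (ltn_ord j)) // !mulr0.
Qed.

(** This serves the value of [pq_derive] at 0, which is an analytic derivative. Induction along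
    Horner's scheme reduces it to the product rule. *)
Lemma is_derive_horner (K : numFieldType) (f : {poly K}) (x : K) :
  is_derive x (1 : K) (horner f : K -> K^o) f^`().[x].
Proof.
elim/poly_ind: f => [|f c IH].
  rewrite deriv0 horner0.
  have -> : horner (0 : {poly K}) = fun=> 0 by apply/funext => y; rewrite horner0.
  exact: (is_derive_cst (0 : K^o)).
have -> : horner (f * 'X + c%:P) = (horner f \* id \+ cst c)%R.
  by apply/funext => y; rewrite !hornerE.
apply: (is_derive_eq (is_deriveD (is_deriveM IH (is_derive_id x (1 : K^o)))
  (is_derive_cst (c : K^o) x (1 : K)))).
by rewrite derivMXaddC !hornerE ?addr0 [_ *: 1]mulr1 [_ *: _]mulrC.
Qed.

Section PQPoly.
Variables (R : realType) (p q : R[i]).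

(** Working on coefficients avoids both the division by x and the special case at 0. *)
Definition pq_deriv_poly (f : {poly R[i]}) : {poly R[i]} :=
  \poly_(i < size f) (pq_nat p q i.+1 * f`_i.+1).

Local Notation D := pq_deriv_poly.

Lemma coef_pq_deriv_poly f i : (D f)`_i = pq_nat p q i.+1 * f`_i.+1.
Proof.
rewrite coef_poly; case: ltnP => // le_fi.
by rewrite [f`__]nth_default ?mulr0 // (leq_trans le_fi).
Qed.

Lemma pq_deriv_poly_linear : linear D.
Proof.
move=> c f g; apply/polyP => i.
by rewrite !(coefD, coefZ, coef_pq_deriv_poly) mulrDr mulrCA.
Qed.

HB.instance Definition _ := GRing.isLinear.Build R[i] {poly R[i]} {poly R[i]}
  _ pq_deriv_poly pq_deriv_poly_linear.

Definition pq_power_poly (a : R[i]) (n : nat) : {poly R[i]} :=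
  \prod_(i < n) (p ^+ i *: 'X - (q ^+ i * a)%:P).

Lemma horner_pq_power_poly a n x : (pq_power_poly a n).[x] = pq_power p q x a n.
Proof. by rewrite horner_prod; apply: eq_bigr => i _; rewrite !hornerE. Qed.

(** The number [n] of terms is independent of the degree of [f], so that induction can run on
    [n]. *)
Definition pq_taylor (n : nat) (f : {poly R[i]}) (a : R[i]) : {poly R[i]} :=
  \sum_(0 <= k < n)
    (p ^- 'C(k, 2) * ((iter k D f).[a * p ^- k] / pq_fact p q k)) *:
    pq_power_poly a k.

Lemma horner_pq_taylor_center n f a : (pq_taylor n.+1 f a).[a] = f.[a].
Proof.
rewrite /pq_taylor big_nat_recl // hornerD hornerZ /pq_power_poly big_ord0.
rewrite /pq_fact big_geq // !expr0 !invr1 !(mulr1, mul1r) hornerC mulr1.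
(* Every remaining term contains the factor of index 0, which is x - a. *)
rewrite horner_sum big1 ?addr0 // => k _.
by rewrite hornerZ horner_pq_power_poly /pq_power big_ord_recl !mul1r subrr mul0r mulr0.
Qed.

Hypothesis p_neq0 : p != 0.
Hypothesis pq_neq : forall n : nat, (1 <= n)%N -> p ^+ n != q ^+ n.

Lemma pq_sub_neq0 : p - q != 0.
Proof. by rewrite subr_eq0; exact: (pq_neq 1). Qed.

Lemma pq_nat_neq0 n : pq_nat p q n.+1 != 0.
Proof. by rewrite mulf_neq0 ?invr_eq0 ?pq_sub_neq0 // subr_eq0 pq_neq. Qed.

Lemma pq_fact_neq0 n : pq_fact p q n != 0.
Proof.
rewrite prodf_seq_neq0; apply/allP => -[|i]; first by rewrite mem_index_iota.
by rewrite pq_nat_neq0.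
Qed.

Lemma pq_nat1 : pq_nat p q 1 = 1.
Proof. by rewrite /pq_nat !expr1 divff ?pq_sub_neq0. Qed.

(** Clearing the denominator (p - q)x gives a polynomial identity valid at 0 too; cancelling that
    factor later recovers [D f]. *)
Lemma pq_deriv_polyE f :
  (p - q) *: ('X * D f) = (f \Po (p *: 'X)) - (f \Po (q *: 'X)).
Proof.
apply/polyP => i; rewrite coefZ coefXM coefB !coef_comp_scaleX.
case: i => [|i] /=; first by rewrite !expr0 subrr mulr0.
by rewrite coef_pq_deriv_poly /pq_nat mulrA mulrCA mulfV ?pq_sub_neq0 //; ring.
Qed.

Lemma pq_deriveE f : pq_derive p q (horner f) = horner (D f).
Proof.
apply/funext => x; rewrite /pq_derive; case: eqVneq => [->|x0].
  (* At 0 both sides are the coefficient of degree 1, because [1] = 1. *)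
  rewrite derive1E (derive_val (is_derive := is_derive_horner _ f 0)).
  by rewrite !horner_coef0 coef_deriv mulr1n coef_pq_deriv_poly pq_nat1 mul1r.
have := congr1 (horner^~ x) (pq_deriv_polyE f).
rewrite hornerZ hornerM hornerX hornerD hornerN !horner_comp !hornerZ !hornerX => <-.
by rewrite mulrA [LHS]mulrC mulKf // mulf_neq0 ?pq_sub_neq0.
Qed.

Lemma pq_derivenE k f : pq_deriven p q k (horner f) = horner (iter k D f).
Proof. by elim: k => // k IH; rewrite /pq_deriven !iterS -pq_deriveE -IH. Qed.

Lemma pq_deriv_poly_inj f g c : D f = D g -> f.[c] = g.[c] -> f = g.
Proof.
move=> Dfg fgc; apply/eqP; rewrite -subr_eq0; apply/eqP.
have fgC : f - g = ((f - g)`_0)%:P.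
  apply/polyP => -[|i]; rewrite coefC //= coefB; apply/eqP.
  have := congr1 (fun h : {poly R[i]} => h`_i) Dfg.
  by rewrite !coef_pq_deriv_poly subr_eq0 => /(mulfI (pq_nat_neq0 i)) ->.
have := congr1 (horner^~ c) fgC.
by rewrite hornerC hornerD hornerN fgc subrr => fg0; rewrite fgC -fg0.
Qed.

Lemma pq_power_poly_scale a n :
  \prod_(i < n) (p ^+ i.+1 *: 'X - (q ^+ i * a)%:P) =
  p ^+ n *: pq_power_poly (a / p) n.
Proof.
rewrite -[n in p ^+ n]card_ord -prodr_const -scaler_prod; apply: eq_bigr => i _.
by rewrite scalerBr scalerA -exprS -[p *: _%:P]mul_polyC -polyCM mulrCA [p * _]mulrC divfK.
Qed.

(** Substituting pX or qX for X leaves the common factor [Q]. The cofactors p^(n+1) X - q^n a and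
    q^n (q X - a) differ by (p^(n+1) - q^(n+1)) X, and (p - q) X cancels. *)
Lemma pq_deriv_power_poly a n :
  D (pq_power_poly a n.+1) = (pq_nat p q n.+1 * p ^+ n) *: pq_power_poly (a / p) n.
Proof.
rewrite -scalerA -pq_power_poly_scale; set Q := \prod_(i < n) _.
have pX : pq_power_poly a n.+1 \Po (p *: 'X) =
    Q * (p ^+ n.+1 *: 'X - (q ^+ n * a)%:P).
  rewrite /pq_power_poly rmorph_prod big_ord_recr /=; congr (_ * _).
    apply: eq_bigr => i _.
    by rewrite comp_polyB comp_polyZ comp_polyX comp_polyC scalerA -exprSr.
  by rewrite comp_polyB comp_polyZ comp_polyX comp_polyC scalerA -exprSr.
have qX : pq_power_poly a n.+1 \Po (q *: 'X) = (q *: 'X - a%:P) * (q ^+ n *: Q).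
  rewrite /pq_power_poly rmorph_prod big_ord_recl /=; congr (_ * _).
    by rewrite !expr0 scale1r mul1r comp_polyB comp_polyX comp_polyC.
  rewrite -[n in q ^+ n]card_ord -prodr_const -scaler_prod; apply: eq_bigr => i _.
  rewrite comp_polyB comp_polyZ comp_polyX comp_polyC scalerBr !scalerA.
  by rewrite -[q *: _%:P]mul_polyC -polyCM mulrA -exprS [q * _]mulrC.
have X0 : (p - q)%:P * 'X != 0 by rewrite mulf_neq0 ?polyX_eq0 ?polyC_eq0 ?pq_sub_neq0.
apply: (mulfI X0).
have := pq_deriv_polyE (pq_power_poly a n.+1).
rewrite -mul_polyC mulrA pX qX => ->.
have natP : (p - q)%:P * (pq_nat p q n.+1)%:P = (p ^+ n.+1)%:P - (q ^+ n.+1)%:P.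
  by rewrite -polyCM -polyCB mulrC divfK ?pq_sub_neq0.
rewrite -!mul_polyC [RHS]mulrACA natP !exprS !polyCM.
by ring.
Qed.

Lemma pq_deriv_taylor n f a :
  D (pq_taylor n.+1 f a) = pq_taylor n (D f) (a / p).
Proof.
rewrite /pq_taylor big_nat_recl // linearD linearZ /=.
have -> : D (pq_power_poly a 0) = 0.
  apply/polyP => i.
  by rewrite coef_pq_deriv_poly /pq_power_poly big_ord0 coef1 coef0 mulr0.
rewrite scaler0 add0r linear_sum; apply: eq_bigr => k _.
rewrite linearZ /= pq_deriv_power_poly scalerA; congr (_ *: _).
(* Since C(k+1,2) = C(k,2) + k, the factor p^k produced by [D] is absorbed, while [k+1] cancels
   against the factorial; the evaluation point is a p^-(k+1) = (a/p) p^-k. *)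
rewrite -iterSr /= binS bin1 exprD /pq_fact big_nat_recr //=.
rewrite -[a / p / p ^+ k]mulrA -invfM -exprS.
by field; rewrite (pq_fact_neq0 k) pq_nat_neq0 !expf_neq0.
Qed.

Lemma pq_taylorE n (f : {poly R[i]}) a : (size f <= n)%N -> pq_taylor n f a = f.
Proof.
(* The center must stay general, since the induction hypothesis is used at a/p. *)
elim: n f a => [|n IH] f a szf.
  by rewrite /pq_taylor big_geq //; apply/esym/eqP; rewrite -size_poly_leq0.
apply: (pq_deriv_poly_inj _ _ a); last exact: horner_pq_taylor_center.
rewrite pq_deriv_taylor IH //; apply/leq_sizeP => i le_ni.
by rewrite coef_pq_deriv_poly nth_default ?mulr0 // (leq_trans szf).
Qed.

End PQPoly.

Theorem theorem3 (R : realType) (p q : R[i])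
    (p_neq0 : p != 0) (q_neq0 : q != 0)
    (pq_neq : forall n : nat, (1 <= n)%N -> p ^+ n != q ^+ n)
    (N : nat) (f : {poly R[i]}) (deg_f : (size f).-1 = N) (a x : R[i]) :
  f.[x] = \sum_(0 <= k < N.+1)
    p ^- 'C(k, 2) *
    (pq_deriven p q k (fun y => f.[y]) (a * p ^- k) / pq_fact p q k) *
    pq_power p q x a k.
Proof.
(* Only an inequality: the zero polynomial has size 0 and gives N = 0. *)
have szf : (size f <= N.+1)%N by rewrite -deg_f leqSpred.
rewrite -{1}(pq_taylorE _ _ _ p_neq0 pq_neq _ _ a szf) horner_sum.
apply: eq_bigr => k _.
by rewrite hornerZ horner_pq_power_poly (pq_derivenE _ _ _ pq_neq).
Qed.
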